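(* Let $\{(x^k,z^k,y^k)\}$ be a sequence generated by the Algorithm with $\varepsilon_k\to0$. Assume that $$\forall k\in\mathbb{N},\ \forall x\in\mathbb{R}^n:\quad \mathcal L_{\mu_k}(x^k,\hat y^k)\le\mathcal L_{\mu_k}(x,\hat y^k)+\varepsilon_k,$$ that $\operatorname{dom} g$ is closed, and that, for all $k\in\mathbb{N}$, $\hat y^{k+1}=0$ if $y^k\notin Y$. Let $\bar x$ be an accumulation point of $\{x^k\}$. Then $\bar x$ is a global minimizer of $x\mapsto\operatorname{dist}(c(x),\operatorname{dom} g)$ and, for all $(x,z)\in\mathbb{R}^n\times\operatorname{dom} g$ such that $\|c(x)-z\|=\operatorname{dist}(c(\bar x),\operatorname{dom} g)$, it holds $$\limsup_{k\to\infty}(f(x^k)+g(z^k))\le f(x)+g(z).$$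
   Context: Setting. $f:\mathbb{R}^n\to\mathbb{R}$ and $c:\mathbb{R}^n\to\mathbb{R}^m$ are twice continuously differentiable; $g:\mathbb{R}^m\to\mathbb{R}\cup\{\infty\}$ is proper, lower semicontinuous and prox-bounded, i.e. $g+\|\cdot\|^2/(2\mu)$ is bounded below for some $\mu>0$; $\mu_g\in(0,\infty]$ denotes the supremum of all such $\mu$. Problem (P) is to minimize $\varphi(x):=f(x)+g(c(x))$ over $x\in\mathbb{R}^n$, and $\inf\varphi\in\mathbb{R}$. No convexity is assumed. $\operatorname{dom} g:=\{z:g(z)<\infty\}$. Norms are Euclidean. Augmented Lagrangian: for $\mu>0$, $\mathcal L_\mu(x,y):=f(x)+g^\mu(c(x)+\mu y)-\frac\mu2\|y\|^2$, where $g^\mu(w):=\inf_{z}\{g(z)+\frac1{2\mu}\|z-w\|^2\}$ is the Moreau envelope. Proximal mapping: $\operatorname{prox}_{\mu g}(w):=\arg\min_{z}\{g(z)+\frac1{2\mu}\|z-w\|^2\}$ (set-valued). Algorithm (safeguarded implicit augmented Lagrangian method). Data: $\mu_0\in(0,\mu_g)$, $\theta\in(0,1)$, $\kappa\in(0,1)$, a nonempty bounded set $Y\subseteq\mathbb{R}^m$. For $k=0,1,2,\dots$: 1. select $\hat y^k\in Y$ and $\varepsilon_k\ge0$; 2. compute $(x^k,z^k)$ with $z^k\in\operatorname{prox}_{\mu_k g}(c(x^k)+\mu_k\hat y^k)$ and $\|\nabla f(x^k)+c'(x^k)^\top(\hat y^k+\mu_k^{-1}[c(x^k)-z^k])\|\le\varepsilon_k$;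 3. set $y^k:=\hat y^k+\mu_k^{-1}[c(x^k)-z^k]$ and $V_k:=\|c(x^k)-z^k\|$; 4. if $k=0$ or $V_k\le\theta V_{k-1}$ set $\mu_{k+1}:=\mu_k$, otherwise $\mu_{k+1}:=\kappa\mu_k$. The algorithm is assumed to be well defined and to generate infinite sequences. *)

(* Defs.v *)
From HB Require Import structures.
From mathcomp Require Import all_boot all_order all_algebra.
From mathcomp Require Import all_classical all_reals all_analysis.

Set Implicit Arguments.
Unset Strict Implicit.
Unset Printing Implicit Defensive.
Import Order.TTheory GRing.Theory Num.Theory.
Import numFieldNormedType.Exports.

Local Open Scope classical_set_scope.
Local Open Scope ring_scope.

(* R^n is 'rV[R]_n.  The library norm `|v| on it is the sup norm; it is used
   only through norm-independent notions (topology, boundedness,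
   differentiability).  Every norm written in a formula is the Euclidean one. *)
Definition norm2 (R : realType) (n : nat) (v : 'rV[R]_n) : R :=
  Num.sqrt (\sum_(i < n) v ord0 i ^+ 2).

Definition setdist (R : realType) (m : nat) (w : 'rV[R]_m) (A : set 'rV[R]_m) : R :=
  inf [set norm2 (w - z) | z in A].

(* As R^n is finite-dimensional, x |-> 'd f x is continuous in operator norm
   iff x |-> 'D_v f x is continuous for every direction v. *)
Definition continuously_differentiable (R : realType) (n : nat)
    (W : normedModType R) (f : 'rV[R]_n -> W) : Prop :=
  (forall x, differentiable f x) /\ (forall v, continuous (fun x => 'D_v f x)).

Definition twice_continuously_differentiable (R : realType) (n : nat)
    (W : normedModType R) (f : 'rV[R]_n -> W) : Prop :=
  (forall x, differentiable f x) /\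
  (forall v, continuously_differentiable (fun x => 'D_v f x)).

Definition gradient (R : realType) (n : nat) (f : 'rV[R]_n -> R) (x : 'rV[R]_n) :
    'rV[R]_n :=
  \row_(j < n) 'D_(delta_mx ord0 j) f x.

Definition effective_domain (R : realType) (m : nat) (g : 'rV[R]_m -> \bar R) :
    set 'rV[R]_m :=
  [set z | (g z < +oo)%E].

Definition proper_function (R : realType) (m : nat) (g : 'rV[R]_m -> \bar R) : Prop :=
  (forall z, g z != -oo%E) /\ effective_domain g !=set0.

(* The mu > 0 for which g + |.|^2 / (2 mu) is bounded below. *)
Definition prox_parameters (R : realType) (m : nat) (g : 'rV[R]_m -> \bar R) : set R :=
  [set mu | 0 < mu /\
    exists M : R, forall z, (M%:E <= g z + (norm2 z ^+ 2 / (2 * mu))%:E)%E].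

Definition prox_bounded (R : realType) (m : nat) (g : 'rV[R]_m -> \bar R) : Prop :=
  prox_parameters g !=set0.

Definition prox_threshold (R : realType) (m : nat) (g : 'rV[R]_m -> \bar R) : \bar R :=
  ereal_sup [set mu%:E | mu in prox_parameters g].

Definition prox_objective (R : realType) (m : nat) (g : 'rV[R]_m -> \bar R)
    (mu : R) (w z : 'rV[R]_m) : \bar R :=
  (g z + ((2 * mu)^-1 * norm2 (z - w) ^+ 2)%:E)%E.

Definition moreau (R : realType) (m : nat) (g : 'rV[R]_m -> \bar R)
    (mu : R) (w : 'rV[R]_m) : \bar R :=
  ereal_inf (range (prox_objective g mu w)).

Definition prox (R : realType) (m : nat) (g : 'rV[R]_m -> \bar R)
    (mu : R) (w : 'rV[R]_m) : set 'rV[R]_m :=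
  [set z | forall z', (prox_objective g mu w z <= prox_objective g mu w z')%E].

Definition augmented_lagrangian (R : realType) (n m : nat) (f : 'rV[R]_n -> R)
    (c : 'rV[R]_n -> 'rV[R]_m) (g : 'rV[R]_m -> \bar R) (mu : R)
    (x : 'rV[R]_n) (y : 'rV[R]_m) : \bar R :=
  ((f x)%:E + moreau g mu (c x + mu *: y)%R - (mu / 2 * norm2 y ^+ 2)%:E)%E.

(* The library's jacobian acts on row vectors, 'D_v c x = v *m jacobian c x,
   so that the row vector y *m (jacobian c x)^T is c'(x)^T y. *)
Record algorithm_run (R : realType) (n m : nat) (f : 'rV[R]_n -> R)
    (c : 'rV[R]_n -> 'rV[R]_m) (g : 'rV[R]_m -> \bar R)
    (mu0 theta kappa : R) (Y : set 'rV[R]_m)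
    (mu eps : nat -> R) (x : nat -> 'rV[R]_n) (z y yhat : nat -> 'rV[R]_m) :
    Prop := AlgorithmRun {
  run_mu0 : mu 0%N = mu0;
  run_yhat : forall k, Y (yhat k);
  run_eps : forall k, 0 <= eps k;
  run_prox : forall k, prox g (mu k) (c (x k) + mu k *: yhat k) (z k);
  run_stationary : forall k,
    norm2 (gradient f (x k) +
      (yhat k + (mu k)^-1 *: (c (x k) - z k)) *m (jacobian c (x k))^T) <= eps k;
  run_y : forall k, y k = yhat k + (mu k)^-1 *: (c (x k) - z k);
  run_mu : forall k,
    mu k.+1 = if (k == 0%N) ||
                 (norm2 (c (x k) - z k) <= theta * norm2 (c (x k.-1) - z k.-1))
              then mu k else kappa * mu k
}.

(* Main.v *)
Require Import Defs.
From HB Require Import structures.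
From mathcomp Require Import all_boot all_order all_algebra.
From mathcomp Require Import all_classical all_reals all_analysis.
From mathcomp Require Import ring lra.

Set Implicit Arguments.
Unset Strict Implicit.
Unset Printing Implicit Defensive.
Import Order.TTheory GRing.Theory Num.Theory.
Import numFieldNormedType.Exports.

Local Open Scope classical_set_scope.
Local Open Scope ring_scope.

(** Why the theorem holds. Completing the square in the Moreau envelope turns
    near-minimality of [x k] for the implicit augmented Lagrangian into
    near-minimality of the pair [(x k, z k)] for the classical augmented
    Lagrangian of the constraint [c x - z = 0] (lemma [split_near_minimal]): with
    [v = c x' - z'] and [v k = c (x k) - z k],

      f (x k) + g (z k) + <yhat k, v k> + |v k|^2 / (2 mu k)
        <= f x' + g z' + <yhat k, v> + |v|^2 / (2 mu k) + eps k

    for all [x'] and all [z'] in the domain of [g]. The update rule leaves two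
    possibilities ([penalty_dichotomy]): the residuals [v k] tend to [0], or the
    parameters [mu k] do.

    Minimality of the distance [d] from [c xbar] to the domain. If [v k] tends to
    [0], then [d = 0]. If [mu k] tends to [0], multiplying the inequality by
    [2 (mu k)] leaves [|v k|^2 <= |v|^2] in the limit along iterates close to
    [xbar]; the term [g (z k)] is under control because prox-boundedness gives a
    quadratic minorant of [g] ([vanishing_penalty_minimal]). Since
    [|v k| >= dist (c (x k), dom g)], this yields [d <= |v|].

    The upper limit. Let [|v| = d]. By the first part
    [d <= dist (c (x k), dom g) <= |v k|] for every [k], not only for the iterates
    close to [xbar], so the quadratic term on the right never exceeds the one on
    the left, and only the multiplier terms can interfere.
    - If [d > 0], then [mu k] tends to [0], the residuals stay away from [0], and
      [y k] is unbounded; safeguarding then resets the multiplier to [0]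
      ([multiplier_eventually0]).
    - If [d = 0], then [v = 0], and the left-hand side exceeds
      [f (x k) + g (z k)] by a quantity bounded below both by [- B |v k|] and by
      [- mu k B^2 / 2], where [B] bounds [Y]; one of these tends to [0]. *)

(** * Euclidean geometry of row vectors *)

Definition dot (R : realType) (m : nat) (u v : 'rV[R]_m) : R :=
  \sum_(i < m) u ord0 i * v ord0 i.

Lemma dotC (R : realType) (m : nat) (u v : 'rV[R]_m) : dot u v = dot v u.
Proof. by apply: eq_bigr => i _; rewrite mulrC. Qed.

Lemma dotDl (R : realType) (m : nat) (u v w : 'rV[R]_m) :
  dot (u + v) w = dot u w + dot v w.
Proof. by rewrite -big_split; apply: eq_bigr => i _; rewrite mxE mulrDl. Qed.

Lemma dotZl (R : realType) (m : nat) (a : R) (u v : 'rV[R]_m) :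
  dot (a *: u) v = a * dot u v.
Proof. by rewrite mulr_sumr; apply: eq_bigr => i _; rewrite mxE mulrA. Qed.

Lemma dotvv (R : realType) (m : nat) (v : 'rV[R]_m) : dot v v = norm2 v ^+ 2.
Proof.
rewrite /norm2 sqr_sqrtr; last by apply: sumr_ge0 => i _; exact: sqr_ge0.
by apply: eq_bigr => i _; rewrite expr2.
Qed.

Lemma dot0l (R : realType) (m : nat) (v : 'rV[R]_m) : dot 0 v = 0.
Proof. by rewrite -(scale0r v) dotZl mul0r. Qed.

Lemma norm2_ge0 (R : realType) (m : nat) (v : 'rV[R]_m) : 0 <= norm2 v.
Proof. exact: sqrtr_ge0. Qed.

Lemma norm2N (R : realType) (m : nat) (v : 'rV[R]_m) : norm2 (- v) = norm2 v.
Proof. by congr Num.sqrt; apply: eq_bigr => i _; rewrite mxE sqrrN. Qed.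

Lemma norm2_sqrD (R : realType) (m : nat) (u v : 'rV[R]_m) :
  norm2 (u + v) ^+ 2 = norm2 u ^+ 2 + 2 * dot u v + norm2 v ^+ 2.
Proof. by rewrite -!dotvv dotDl !(dotC _ (u + v)) !dotDl (dotC v u); ring. Qed.

Lemma norm2_scale_sqr (R : realType) (m : nat) (a : R) (v : 'rV[R]_m) :
  norm2 (a *: v) ^+ 2 = a ^+ 2 * norm2 v ^+ 2.
Proof. by rewrite -!dotvv dotZl dotC dotZl; ring. Qed.

Lemma norm2_eq0 (R : realType) (m : nat) (v : 'rV[R]_m) : norm2 v = 0 -> v = 0.
Proof.
move=> v0; have := dotvv v; rewrite v0 expr0n /= => /eqP.
rewrite psumr_eq0; last by move=> i _; rewrite -expr2 sqr_ge0.
move=> /allP h; apply/rowP => i; rewrite mxE; apply/eqP.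
by have := h i (mem_index_enum i); rewrite /= mulf_eq0 orbb.
Qed.

(** Cauchy-Schwarz, from the nonnegativity of [| |v| u - |u| v |^2]. *)
Lemma dot_le_norm2 (R : realType) (m : nat) (u v : 'rV[R]_m) :
  dot u v <= norm2 u * norm2 v.
Proof.
have [->|u_neq0] := eqVneq u 0; first by rewrite dot0l mulr_ge0 ?norm2_ge0.
have [->|v_neq0] := eqVneq v 0.
  by rewrite dotC dot0l mulr_ge0 ?norm2_ge0.
have norm2_gt0 (w : 'rV[R]_m) : w != 0 -> 0 < norm2 w.
  by move=> w0; rewrite lt0r norm2_ge0 andbT; apply: contra_neq w0 => /norm2_eq0.
have u0 := norm2_gt0 _ u_neq0; have v0 := norm2_gt0 _ v_neq0.
have := sqr_ge0 (norm2 (norm2 v *: u + (- norm2 u) *: v)).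
rewrite norm2_sqrD !norm2_scale_sqr sqrrN dotZl dotC dotZl (dotC v u).
set a := norm2 u; set b := norm2 v => h.
have : 0 <= (2 * (a * b)) * (a * b - dot u v).
  by move: h; congr (0 <= _); ring.
by rewrite pmulr_rge0 ?subr_ge0 // !mulr_gt0.
Qed.

Lemma dot_norm_le (R : realType) (m : nat) (u v : 'rV[R]_m) :
  `|dot u v| <= norm2 u * norm2 v.
Proof.
rewrite ler_norml dot_le_norm2 andbT lerNl -(norm2N u) -mulN1r -dotZl scaleN1r.
exact: dot_le_norm2.
Qed.

Lemma norm2_triangle (R : realType) (m : nat) (u v : 'rV[R]_m) :
  norm2 (u + v) <= norm2 u + norm2 v.
Proof.
rewrite -(@ler_pXn2r _ 2) ?nnegrE ?addr_ge0 ?norm2_ge0 // norm2_sqrD.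
have := dot_le_norm2 u v; set a := norm2 u; set b := norm2 v; nra.
Qed.

(** One half of the equivalence of the Euclidean and the sup norm; it carries
    continuity and boundedness, which refer to the sup norm, over to [norm2]. *)
Lemma norm2_le_sup (R : realType) (m : nat) (v : 'rV[R]_m) :
  norm2 v <= m%:R * `|v|.
Proof.
have coord (i : 'I_m) : `|v ord0 i| <= `|v|.
  rewrite /Num.norm /= mx_normrE.
  exact: (le_bigmax _ (fun ij : 'I_1 * 'I_m => `|v ij.1 ij.2|) (ord0, i)).
rewrite -(@ler_pXn2r _ 2) ?nnegrE ?norm2_ge0 ?mulr_ge0 //.
apply: (@le_trans _ _ (m%:R * `|v| ^+ 2)).
  rewrite -dotvv mulr_natl -[X in _ *+ X]card_ord -sumr_const.
  by apply: ler_sum => i _; rewrite -expr2 -real_normK ?num_real // lerXn2r ?nnegrE.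
rewrite exprMn ler_wpM2r ?sqr_ge0 // -natrX ler_nat.
by case: (m) => // k; rewrite expnS expn1 leq_pmull.
Qed.

(** * Distance to a set *)

Lemma setdist_le (R : realType) (m : nat) (w z : 'rV[R]_m) (A : set 'rV[R]_m) :
  A z -> setdist w A <= norm2 (w - z).
Proof.
move=> Az; apply: ge_inf; last by exists z.
by exists 0 => _ [u _ <-]; exact: norm2_ge0.
Qed.

Lemma le_setdist (R : realType) (m : nat) (w : 'rV[R]_m) (A : set 'rV[R]_m)
    (r : R) :
  A !=set0 -> (forall z, A z -> r <= norm2 (w - z)) -> r <= setdist w A.
Proof.
move=> [z Az] h; apply: lb_le_inf; first by exists (norm2 (w - z)), z.
by move=> _ [u Au <-]; exact: h.
Qed.

(** * The proximal subproblem and the augmented Lagrangian *)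

Lemma effective_domain_fin_num (R : realType) (m : nat) (g : 'rV[R]_m -> \bar R)
    (z : 'rV[R]_m) :
  proper_function g -> effective_domain g z -> g z \is a fin_num.
Proof. by move=> [gNy _] gz; rewrite fin_numE gNy lt_eqF. Qed.

Lemma prox_effective_domain (R : realType) (m : nat) (g : 'rV[R]_m -> \bar R)
    (mu : R) (w z : 'rV[R]_m) :
  proper_function g -> prox g mu w z -> effective_domain g z.
Proof.
move=> g_proper zprox; have [z0 gz0] := g_proper.2.
have := zprox z0; rewrite /prox_objective /effective_domain /=.
rewrite -(fineK (effective_domain_fin_num g_proper gz0)) -EFinD.
by case: (g z) => [r||] //= _; rewrite ltry.
Qed.

Lemma prox_moreau (R : realType) (m : nat) (g : 'rV[R]_m -> \bar R)
    (mu : R) (w z : 'rV[R]_m) :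
  prox g mu w z -> moreau g mu w = prox_objective g mu w z.
Proof.
move=> zprox; apply/eqP; rewrite eq_le; apply/andP; split.
  by apply: ereal_inf_lbound; exists z.
by apply: le_ereal_inf_tmp => _ [z' _ <-].
Qed.

(** The value, at a residual [v = c x - z], of the classical augmented
    Lagrangian term for the constraint [c x - z = 0] with multiplier [y]. *)
Definition multiplier_penalty (R : realType) (m : nat) (mu : R)
    (y v : 'rV[R]_m) : R :=
  dot y v + (2 * mu)^-1 * norm2 v ^+ 2.

(** Completing the square: this makes the implicit augmented Lagrangian the
    marginal function, over [z], of the classical one for the splitting
    [c x - z = 0]. *)
Lemma complete_square (R : realType) (m : nat) (mu : R) (w y z : 'rV[R]_m) :
  mu != 0 ->
  (2 * mu)^-1 * norm2 (z - (w + mu *: y)) ^+ 2 - mu / 2 * norm2 y ^+ 2 =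
  multiplier_penalty mu y (w - z).
Proof.
move=> mu0; rewrite -norm2N.
have -> : - (z - (w + mu *: y)) = (w - z) + mu *: y by rewrite opprB addrAC.
rewrite norm2_sqrD norm2_scale_sqr dotC dotZl /multiplier_penalty.
by field.
Qed.

(** Near-minimality of [x] for the augmented Lagrangian, read as near-minimality
    of the pair [(x, z)] in the split formulation. *)
Lemma split_near_minimal (R : realType) (n m : nat)
    (f : 'rV[R]_n -> R) (c : 'rV[R]_n -> 'rV[R]_m) (g : 'rV[R]_m -> \bar R)
    (mu e : R) (x x' : 'rV[R]_n) (y z z' : 'rV[R]_m) :
  proper_function g -> mu != 0 ->
  prox g mu (c x + mu *: y) z ->
  (augmented_lagrangian f c g mu x y <=
   augmented_lagrangian f c g mu x' y + e%:E)%E ->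
  effective_domain g z' ->
  f x + fine (g z) + multiplier_penalty mu y (c x - z) <=
  f x' + fine (g z') + multiplier_penalty mu y (c x' - z') + e.
Proof.
move=> g_proper mu0 zprox + gz'.
have gz := prox_effective_domain g_proper zprox.
have le_prox : (moreau g mu (c x' + mu *: y) <=
                prox_objective g mu (c x' + mu *: y) z')%E.
  by apply: ereal_inf_lbound; exists z'.
rewrite /augmented_lagrangian (prox_moreau zprox) => near_min.
have {near_min} : ((f x)%:E + prox_objective g mu (c x + mu *: y) z
    - (mu / 2 * norm2 y ^+ 2)%:E <=
    (f x')%:E + prox_objective g mu (c x' + mu *: y) z'
    - (mu / 2 * norm2 y ^+ 2)%:E + e%:E)%E.
  by apply: le_trans near_min _; rewrite leeD2r // leeD2r // leeD2l.
rewrite /prox_objective.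
rewrite -(fineK (effective_domain_fin_num g_proper gz)).
rewrite -(fineK (effective_domain_fin_num g_proper gz')).
rewrite -!(EFinB, EFinD) lee_fin -!(complete_square _ _ _ mu0) /=.
by lra.
Qed.

(** Young's inequality, read off the completed square at [z = 0]. *)
Lemma multiplier_penalty_ge (R : realType) (m : nat) (mu : R)
    (y v : 'rV[R]_m) :
  0 < mu -> - (mu / 2 * norm2 y ^+ 2) <= multiplier_penalty mu y v.
Proof.
move=> mu0; rewrite -[v]subr0 -complete_square ?gt_eqF // lerBrDl subrr.
by rewrite mulr_ge0 ?sqr_ge0 // invr_ge0 mulr_ge0 ?ltW.
Qed.

Lemma prox_bounded_minorant (R : realType) (m : nat) (g : 'rV[R]_m -> \bar R) :
  proper_function g -> prox_bounded g ->
  exists a M : R, 0 <= a /\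
    forall z, effective_domain g z -> M - a * norm2 z ^+ 2 <= fine (g z).
Proof.
move=> g_proper [nu [nu0 [M hM]]]; exists (2 * nu)^-1, M; split.
  by rewrite invr_ge0 mulr_ge0 ?ltW.
move=> z gz; have := hM z.
rewrite -(fineK (effective_domain_fin_num g_proper gz)) -EFinD lee_fin /=.
by rewrite lerBlDr mulrC.
Qed.

(** * The penalty update *)

(** Either the decrease test eventually always succeeds, and [V] decays
    geometrically, or it fails infinitely often, and each failure multiplies the
    nonincreasing [mu] by [kappa]. *)
Lemma penalty_dichotomy (R : realType) (theta kappa : R) (mu V : nat -> R) :
  0 < theta -> theta < 1 -> 0 < kappa -> kappa < 1 ->
  0 < mu 0%N -> (forall k, 0 <= V k) ->
  (forall k, mu k.+1 = if (k == 0%N) || (V k <= theta * V k.-1)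
                       then mu k else kappa * mu k) ->
  (forall k, 0 < mu k) /\ (V @ \oo --> (0 : R) \/ mu @ \oo --> (0 : R)).
Proof.
move=> th0 th1 ka0 ka1 mu0 V0 step.
have mu_gt0 k : 0 < mu k.
  by elim: k => // k ih; rewrite step; case: ifP => // _; rewrite mulr_gt0.
split=> //.
have mu_le k l : (k <= l)%N -> mu l <= mu k.
  move=> /subnK <-; elim: (l - k)%N => // j ih; rewrite addSn step.
  apply: le_trans ih; case: ifP => // _; have := mu_gt0 (j + k)%N; nra.
have [[K hK]|fails] := pselect (exists K, forall k, (K <= k)%N ->
    (k == 0%N) || (V k <= theta * V k.-1)).
  left; have geo j : 0 <= V (j + K.+1)%N <= V K.+1 * theta ^+ j.
    rewrite V0 /=; elim: j => [|j ih]; first by rewrite expr0 mulr1.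
    have Kj : (K <= j.+1 + K.+1)%N by rewrite (leq_trans (leqnSn K)) ?leq_addl.
    have := hK _ Kj; rewrite addSn /= => /le_trans; apply; rewrite exprS.
    by rewrite mulrCA ler_wpM2l // ltW.
  rewrite -(cvg_shiftn K.+1).
  have theta_cvg : geometric (V K.+1) theta @ \oo --> (0 : R).
    by apply: cvg_geometric; rewrite gtr0_norm.
  apply: (squeeze_cvgr _ (cvg_cst 0) theta_cvg).
  by apply: nearW => j; exact: geo.
(* the parameter never increases, so one small value bounds all later ones *)
right; have below j : exists K, mu K <= mu 0%N * kappa ^+ j.
  elim: j => [|j [K hK]]; first by exists 0%N; rewrite expr0 mulr1.
  have [k [Kk /negP/negbTE fail]] : exists k, (K <= k)%N /\
      ~ ((k == 0%N) || (V k <= theta * V k.-1)).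
    apply: contrapT => no; apply: fails; exists K => k Kk.
    by apply: contrapT => h; apply: no; exists k.
  exists k.+1; rewrite step fail exprS mulrCA ler_wpM2l ?(ltW ka0) //.
  exact: le_trans (mu_le _ _ Kk) hK.
apply/cvgr0Pnorm_lt => e e0.
have : \forall j \near \oo, `|geometric (mu 0%N) kappa j| < e.
  by apply: cvgr0_norm_lt => //; apply: cvg_geometric; rewrite gtr0_norm.
move=> [j _ /(_ j (leqnn j)) /= hj]; have [K hK] := below j.
exists K => // k /= Kk; rewrite gtr0_norm //.
apply: le_lt_trans hj; apply: le_trans (ler_norm _).
exact: le_trans (mu_le _ _ Kk) hK.
Qed.

(** * Limits along the iterates *)

Lemma eventually_lt (R : realType) (u : nat -> R) (e : R) :
  u @ \oo --> (0 : R) -> 0 < e -> \forall k \near \oo, u k < e.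
Proof. by move=> u_cvg; exact: (cvgr_lt _ u_cvg). Qed.

Lemma cluster_seq (R : realType) (V : normedModType R) (u : nat -> V) (p : V)
    (P : nat -> Prop) (U : set V) :
  cluster (u @ \oo) p -> (\forall k \near \oo, P k) -> nbhs p U ->
  exists k, P k /\ U (u k).
Proof.
move=> clu nearP pU.
have [_ [[k Pk <-] Uuk]] : (u @` [set k | P k]) `&` U !=set0.
  by apply: clu => //; apply: filterS nearP => k Pk; exists k.
by exists k.
Qed.

Lemma continuous_norm2_sub (R : realType) (n m : nat)
    (c : 'rV[R]_n -> 'rV[R]_m) (p : 'rV[R]_n) (r : R) :
  {for p, continuous c} -> 0 < r -> \forall x \near p, norm2 (c p - c x) < r.
Proof.
move=> cp r0; have m0 : 0 < m%:R + 1 :> R by rewrite ltr_wpDl.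
move/cvgrPdist_lt: cp => /(_ _ (divr_gt0 r0 m0)); apply: filterS => x.
rewrite ltr_pdivlMr // => cx; apply: le_lt_trans (norm2_le_sup _) _.
apply: le_lt_trans cx; rewrite mulrC; apply: ler_wpM2l; first exact: normr_ge0.
by rewrite lerDl.
Qed.

Lemma bounded_set_norm2 (R : realType) (m : nat) (Y : set 'rV[R]_m) :
  bounded_set Y -> exists B : R, 0 <= B /\ forall y, Y y -> norm2 y <= B.
Proof.
move=> [M [_ hM]]; exists (m%:R * (`|M| + 1)); split.
  by rewrite mulr_ge0 // addr_ge0.
move=> y Yy; apply: le_trans (norm2_le_sup _) _; rewrite ler_wpM2l //.
by apply: hM => //; rewrite ltr_pwDr // ler_norm.
Qed.

Lemma limn_esup_le (R : realType) (u : nat -> \bar R) (A : R) :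
  (forall e : R, 0 < e -> \forall k \near \oo, (u k <= (A + e)%:E)%E) ->
  (limn_esup u <= A%:E)%E.
Proof.
move=> h; apply/lee_addgt0Pr => e /h near_le.
apply: (@le_trans _ _ (ereal_sup [set u k | k in [set k | (u k <= (A + e)%:E)%E]])).
  by apply: ereal_inf_lbound; exists [set k | (u k <= (A + e)%:E)%E].
by apply: ge_ereal_sup => _ [k hk <-]; rewrite -EFinD.
Qed.

(** * Vanishing penalty parameters *)

(** A gap [W < d <= V] between two residual norms is amplified by [1 / (2 mu)]
    and so outweighs [b V^2 + K] once [mu] is small; the threshold does not depend
    on [V], which need not be bounded beforehand. *)
Lemma small_penalty_excess (R : realType) (b K W d mu V : R) :
  0 <= b -> 0 <= W -> W < d -> d <= V -> 0 < mu ->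
  mu < (d ^+ 2 - W ^+ 2) / (2 * (b * d ^+ 2 + `|K| + 1)) ->
  W ^+ 2 / (2 * mu) + b * V ^+ 2 + K < V ^+ 2 / (2 * mu).
Proof.
move=> b0 W0 Wd dV mu0; have K0 := normr_ge0 K; have KK := ler_norm K.
have d2 : 0 < d ^+ 2 by rewrite exprn_gt0 //; lra.
have bd0 : 0 <= b * d ^+ 2 by rewrite mulr_ge0 // ltW.
rewrite ltr_pdivlMr; last by lra.
move=> small; have b_small : 2 * mu * b * d ^+ 2 <= 1 * d ^+ 2.
  have := sqr_ge0 W; have := mulr_ge0 (ltW mu0) K0; nra.
rewrite ler_pM2r // in b_small.
have dV2 : d ^+ 2 <= V ^+ 2 by rewrite lerXn2r ?nnegrE //; lra.
have muK : mu * K <= mu * `|K| by rewrite ler_wpM2l // ltW.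
have mu2 : 0 < 2 * mu by lra.
rewrite ltr_pdivlMr //.
have -> : (W ^+ 2 / (2 * mu) + b * V ^+ 2 + K) * (2 * mu) =
    W ^+ 2 + 2 * mu * b * V ^+ 2 + 2 * (mu * K) by field; rewrite gt_eqF.
have : 0 <= (1 - 2 * mu * b) * (V ^+ 2 - d ^+ 2) by rewrite mulr_ge0 // subr_ge0.
nra.
Qed.

(** Multiplying the near-minimality inequality by [mu k] leaves only the
    squared residuals in the limit. Prox-boundedness is what prevents the values
    [G k], which may tend to [-oo], from compensating a large residual. *)
Lemma vanishing_penalty_minimal (R : realType) (n m : nat)
    (f : 'rV[R]_n -> R) (c : 'rV[R]_n -> 'rV[R]_m) (A : set 'rV[R]_m)
    (G mu eps : nat -> R) (x : nat -> 'rV[R]_n) (z y : nat -> 'rV[R]_m)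
    (a M B r : R) (p x' : 'rV[R]_n) (z' : 'rV[R]_m) :
  {for p, continuous f} -> {for p, continuous c} ->
  cluster (x @ \oo) p ->
  (forall k, A (z k)) ->
  0 <= a -> (forall k, M - a * norm2 (z k) ^+ 2 <= G k) ->
  0 <= B -> (forall k, norm2 (y k) <= B) ->
  (forall k, 0 < mu k) -> mu @ \oo --> (0 : R) -> eps @ \oo --> (0 : R) ->
  (forall k, f (x k) + G k + multiplier_penalty (mu k) (y k) (c (x k) - z k) <=
     f x' + r + multiplier_penalty (mu k) (y k) (c x' - z') + eps k) ->
  setdist (c p) A <= norm2 (c x' - z').
Proof.
move=> fp cp clu Az a0 hG B0 hy mu0 mu_cvg eps_cvg near_min.
(* the midpoint d leaves half of the gap as room for the motion of c (x k) *)
rewrite leNgt; apply/negP; set W := norm2 (c x' - z'); set D := setdist _ _ => WD.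
have W0 : 0 <= W by exact: norm2_ge0.
pose d := (W + D) / 2; pose C := norm2 (c p) + (D - d).
pose b := 2 * a + 1.
(* the constant collects everything that stays bounded along the iterates *)
pose K := f x' + r + B * W + 1 - (f p - 1) - M + 2 * a * C ^+ 2 + B ^+ 2.
have b0 : 0 <= b by rewrite /b; lra.
have Wd : W < d by rewrite /d; lra.
have dD : 0 < D - d by rewrite /d; lra.
have C0 : 0 <= C by rewrite addr_ge0 ?norm2_ge0 // ltW.
have t0 : 0 < (d ^+ 2 - W ^+ 2) / (2 * (b * d ^+ 2 + `|K| + 1)).
  have := normr_ge0 K; have := mulr_ge0 b0 (sqr_ge0 d) => bd K0.
  rewrite divr_gt0 //; [nra|lra].
have late : \forall k \near \oo,
    mu k < (d ^+ 2 - W ^+ 2) / (2 * (b * d ^+ 2 + `|K| + 1)) /\ eps k < 1.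
  apply: filterI; first exact: (eventually_lt mu_cvg t0).
  exact: (eventually_lt eps_cvg ltr01).
have close : \forall u \near p, `|f p - f u| < 1 /\ norm2 (c p - c u) < D - d.
  apply: filterI; last exact: continuous_norm2_sub.
  by move/cvgrPdist_lt: fp => /(_ 1 ltr01).
have [k [[mu_small eps_small] [f_close c_close]]] := cluster_seq clu late close.
have := near_min k; rewrite /multiplier_penalty -/W.
set V := norm2 (c (x k) - z k).
have V0 : 0 <= V by exact: norm2_ge0.
have dV : d <= V.
  have := setdist_le (c p) (Az k); rewrite -/D.
  have := norm2_triangle (c p - c (x k)) (c (x k) - z k).
  by rewrite subrKA -/V; lra.
have zV : norm2 (z k) <= C + V.
  have -> : z k = c p + (- (c p - c (x k)) - (c (x k) - z k)).
    by apply/rowP => i; rewrite !mxE; ring.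
  have := norm2_triangle (c p) (- (c p - c (x k)) - (c (x k) - z k)).
  have := norm2_triangle (- (c p - c (x k))) (- (c (x k) - z k)).
  by rewrite !norm2N -/V /C; lra.
have {}zV : a * norm2 (z k) ^+ 2 <= 2 * a * C ^+ 2 + 2 * a * V ^+ 2.
  rewrite -mulrDr -(mulrC a) -mulrA ler_wpM2l //.
  apply: (@le_trans _ _ ((C + V) ^+ 2)).
    by rewrite lerXn2r ?nnegrE ?norm2_ge0 // addr_ge0.
  have := sqr_ge0 (C - V); nra.
have yV : - dot (y k) (c (x k) - z k) <= B ^+ 2 + V ^+ 2.
  have := dot_norm_le (y k) (c (x k) - z k); rewrite ler_norml -/V.
  have := ler_wpM2r V0 (hy k); have := sqr_ge0 (B - V).
  move=> h1 h2 /andP[h3 _]; nra.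
have yW : dot (y k) (c x' - z') <= B * W.
  exact: le_trans (dot_le_norm2 _ _) (ler_wpM2r W0 (hy k)).
have Gk := hG k.
have := small_penalty_excess b0 W0 Wd dV (mu0 k) mu_small.
rewrite !(mulrC _^-1) /b /K; move: f_close; rewrite ltr_norml => /andP[_ f_close].
lra.
Qed.

(** With bounded multipliers, residuals that stay above [d > 0] while [mu]
    vanishes drive [y k] out of [Y], so that the safeguarding rule resets the
    multiplier. *)
Lemma multiplier_eventually0 (R : realType) (m : nat) (Y : set 'rV[R]_m)
    (mu : nat -> R) (v y yhat : nat -> 'rV[R]_m) (B d : R) :
  0 <= B -> (forall w, Y w -> norm2 w <= B) -> (forall k, Y (yhat k)) ->
  (forall k, 0 < mu k) -> mu @ \oo --> (0 : R) ->
  (forall k, y k = yhat k + (mu k)^-1 *: v k) ->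
  (forall k, ~ Y (y k) -> yhat k.+1 = 0) ->
  0 < d -> (forall k, d <= norm2 (v k)) ->
  \forall k \near \oo, yhat k = 0.
Proof.
move=> B0 hB Yhat mu0 mu_cvg hy reset d0 dv.
have [K _ small] : \forall k \near \oo, mu k < d / (2 * B + 1).
  by apply: eventually_lt => //; rewrite divr_gt0 //; lra.
exists K.+1 => // -[//|k] /= Kk; apply: reset => Yy.
have := small k Kk; rewrite /= ltr_pdivlMr; last by lra.
move=> mu_small; have muk := mu0 k.
have vE : v k = mu k *: (y k - yhat k).
  by rewrite hy addrAC subrr add0r scalerA divff ?gt_eqF // scale1r.
have yB : norm2 (y k - yhat k) <= 2 * B.
  have := norm2_triangle (y k) (- yhat k); rewrite norm2N.
  by have := hB _ Yy; have := hB _ (Yhat k); lra.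
have : d ^+ 2 <= (mu k * (2 * B)) ^+ 2.
  apply: (@le_trans _ _ (norm2 (v k) ^+ 2)).
    by rewrite lerXn2r ?nnegrE ?norm2_ge0 // ltW.
  rewrite vE norm2_scale_sqr exprMn ler_wpM2l ?sqr_ge0 //.
  by rewrite lerXn2r ?nnegrE ?norm2_ge0 // mulr_ge0.
rewrite ler_pXn2r ?nnegrE ?(ltW d0) //; last by rewrite !mulr_ge0 // ltW.
by rewrite leNgt => /negP; apply; lra.
Qed.

(** * Global minimality *)

Theorem theorem4p4 (R : realType) (n m : nat)
    (f : 'rV[R]_n -> R) (c : 'rV[R]_n -> 'rV[R]_m) (g : 'rV[R]_m -> \bar R)
    (hf : twice_continuously_differentiable f)
    (hc : twice_continuously_differentiable c)
    (g_proper : proper_function g)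
    (g_lsc : lower_semicontinuous g)
    (g_prox_bounded : prox_bounded g)
    (hinf : ereal_inf (range (fun x => ((f x)%:E + g (c x))%E)) \is a fin_num)
    (mu0 theta kappa : R) (Y : set 'rV[R]_m)
    (mu0_gt0 : 0 < mu0) (mu0_lt : (mu0%:E < prox_threshold g)%E)
    (theta_gt0 : 0 < theta) (theta_lt1 : theta < 1)
    (kappa_gt0 : 0 < kappa) (kappa_lt1 : kappa < 1)
    (Y_nonempty : Y !=set0) (Y_bounded : bounded_set Y)
    (mu eps : nat -> R) (x : nat -> 'rV[R]_n) (z y yhat : nat -> 'rV[R]_m)
    (hrun : algorithm_run f c g mu0 theta kappa Y mu eps x z y yhat)
    (heps : eps @ \oo --> (0 : R))
    (hglobal : forall (k : nat) (x' : 'rV[R]_n),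
      (augmented_lagrangian f c g (mu k) (x k) (yhat k) <=
       augmented_lagrangian f c g (mu k) x' (yhat k) + (eps k)%:E)%E)
    (dom_closed : closed (effective_domain g))
    (hyhat : forall k : nat, ~ Y (y k) -> yhat k.+1 = 0)
    (xbar : 'rV[R]_n) (hxbar : cluster (x @ \oo) xbar) :
  (forall x' : 'rV[R]_n,
     setdist (c xbar) (effective_domain g) <= setdist (c x') (effective_domain g)) /\
  (forall (x' : 'rV[R]_n) (z' : 'rV[R]_m),
     effective_domain g z' ->
     norm2 (c x' - z') = setdist (c xbar) (effective_domain g) ->
     (limn_esup (fun k => (f (x k))%:E + g (z k)) <= (f x')%:E + g z')%E).
Proof.
pose D := effective_domain g; pose V k := norm2 (c (x k) - z k).
have [hmu0 Yhat _ zprox _ hy hmu] := hrun.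
have V0 k : 0 <= V k by exact: norm2_ge0.
have [mu_gt0 V_or_mu] : (forall k, 0 < mu k) /\
    (V @ \oo --> (0 : R) \/ mu @ \oo --> (0 : R)).
  by apply: (penalty_dichotomy theta_gt0 _ kappa_gt0); rewrite ?hmu0.
have Dz k : D (z k) by exact: prox_effective_domain (zprox k).
have [B [B0 hB]] := bounded_set_norm2 Y_bounded.
have yB k : norm2 (yhat k) <= B by exact: hB.
have [a [M [a0 hM]]] := prox_bounded_minorant g_proper g_prox_bounded.
have near_min k x' z' (Dz' : D z') :=
  split_near_minimal g_proper (lt0r_neq0 (mu_gt0 k)) (zprox k) (hglobal k x') Dz'.
have c_cont : {for xbar, continuous c} := differentiable_continuous (hc.1 xbar).
have dist0 : V @ \oo --> (0 : R) -> setdist (c xbar) D <= 0.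
  move=> V_cvg; apply/ler_addgt0Pr => e e0; have e2 : 0 < e / 2 by lra.
  have [k [Vk ck]] := cluster_seq hxbar (eventually_lt V_cvg e2)
    (continuous_norm2_sub c_cont e2).
  have := setdist_le (c xbar) (Dz k).
  have := norm2_triangle (c xbar - c (x k)) (c (x k) - z k).
  by rewrite subrKA; move: Vk ck; rewrite /V; lra.
have minimal x' : setdist (c xbar) D <= setdist (c x') D.
  apply: le_setdist g_proper.2 _ => z' Dz'.
  case: V_or_mu => [/dist0 /le_trans|mu_cvg]; first by apply; exact: norm2_ge0.
  apply: (vanishing_penalty_minimal _ c_cont hxbar Dz a0 (fun k => hM _ (Dz k)) B0 yB
    mu_gt0 mu_cvg heps (fun k => near_min k x' z' Dz')).
  exact: differentiable_continuous (hf.1 xbar).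
split=> // x' z' Dz' distE.
have d_le_V k : setdist (c xbar) D <= V k.
  exact: le_trans (minimal (x k)) (setdist_le _ (Dz k)).
rewrite -(fineK (effective_domain_fin_num g_proper Dz')) -EFinD.
apply: limn_esup_le => e e0.
suff : \forall k \near \oo, f (x k) + fine (g (z k)) <= f x' + fine (g z') + e.
  apply: filterS => k hk.
  by rewrite -(fineK (effective_domain_fin_num g_proper (Dz k))) -EFinD lee_fin.
have e2 : 0 < e / 2 by lra.
have eps_small := eventually_lt heps e2.
have d0 : 0 <= setdist (c xbar) D by rewrite -distE norm2_ge0.
have [dE|d_neq0] := eqVneq (setdist (c xbar) D) 0.
  have near_min0 k : f (x k) + fine (g (z k)) +
      multiplier_penalty (mu k) (yhat k) (c (x k) - z k) <=
      f x' + fine (g z') + eps k.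
    have := near_min k x' z' Dz'; rewrite [c x' - z']norm2_eq0; last by rewrite distE.
    by rewrite {2}/multiplier_penalty dotC dot0l -dotvv dot0l mulr0 !addr0.
  (* v = 0: the multiplier term is at most B |v k| in absolute value *)
  case: V_or_mu => [V_cvg|mu_cvg].
    have e3 : 0 < e / (2 * (B + 1)) by rewrite divr_gt0 //; lra.
    apply: filterS2 eps_small (eventually_lt V_cvg e3) => k epsk.
    rewrite ltr_pdivlMr; last by lra.
    move=> Vk; have := near_min0 k; rewrite /multiplier_penalty -/(V k).
    have : 0 <= (2 * mu k)^-1 * V k ^+ 2.
      by rewrite mulr_ge0 ?sqr_ge0 // invr_ge0 mulr_ge0 // ltW.
    have := dot_norm_le (yhat k) (c (x k) - z k); rewrite ler_norml => /andP[+ _].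
    by have := ler_wpM2r (V0 k) (yB k); have := V0 k; move: Vk epsk; rewrite /V; lra.
  (* V k need not be known to tend to 0 here, so the square absorbs the inner product *)
  have e3 : 0 < e / (B ^+ 2 + 1) by rewrite divr_gt0 // ltr_wpDl ?sqr_ge0.
  apply: filterS2 eps_small (eventually_lt mu_cvg e3) => k epsk.
  rewrite ltr_pdivlMr; last by rewrite ltr_wpDl ?sqr_ge0.
  move=> muk; have := near_min0 k.
  have := multiplier_penalty_ge (yhat k) (c (x k) - z k) (mu_gt0 k).
  have : norm2 (yhat k) ^+ 2 <= B ^+ 2 by rewrite lerXn2r ?nnegrE ?norm2_ge0.
  by move=> /(ler_wpM2l (ltW (mu_gt0 k))); have := mu_gt0 k; lra.
(* here the residuals stay away from 0, and the penalty terms have the right sign *)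
have d_gt0 : 0 < setdist (c xbar) D by rewrite lt0r d_neq0.
case: V_or_mu => [/dist0|mu_cvg]; first by rewrite leNgt d_gt0.
have yhat0 := multiplier_eventually0 B0 hB Yhat mu_gt0 mu_cvg hy hyhat d_gt0 d_le_V.
apply: filterS2 eps_small yhat0 => k epsk yk.
have := near_min k x' z' Dz'.
rewrite /multiplier_penalty yk !dot0l !add0r distE -/(V k).
have : (2 * mu k)^-1 * setdist (c xbar) D ^+ 2 <= (2 * mu k)^-1 * V k ^+ 2.
  by rewrite ler_wpM2l ?lerXn2r ?nnegrE // invr_ge0 mulr_ge0 // ltW.
by rewrite /D; move: epsk => /=; lra.
Qed.
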